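(* Let $A$ be a Banach algebra and $m\in A^{**}$. Consider the following statements. (i) $m\in A$. (ii) $m\cdot A\subseteq A$ and $m\in Z_t^{(l)}(A^{**})$. (iii) $m\cdot A\subseteq A$, $A^*\bigtriangleup m\subseteq\langle A^*A\rangle$, and $m\bigtriangleup E=m$ for some $E\in\mathcal{E}$. (iv) $A\cdot m\subseteq A$, $m\cdot A^*\subseteq\langle AA^*\rangle$, and $E\cdot m=m$ for some $E\in\mathcal{E}$. (v) $A\cdot m\subseteq A$ and $m\in Z_t^{(r)}(A^{**})$. Then (i) $\Longleftrightarrow$ (ii) $\Longleftrightarrow$ (iii) if $A$ is of type $(LM)$, and (i) $\Longleftrightarrow$ (iv) $\Longleftrightarrow$ (v) if $A$ is of type $(RM)$. In particular, (i)–(v) are equivalent if $A$ is of type $(M)$.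
   Context: Notation for a Banach algebra $A$. BAI means bounded (two-sided) approximate identity; WSC means weakly sequentially complete. $A^*$ is an $A$-bimodule via $\langle f\cdot a,b\rangle=\langle f,ab\rangle$, $\langle a\cdot f,b\rangle=\langle f,ba\rangle$; $A^*A=\{f\cdot a\}$, $AA^*=\{a\cdot f\}$, and $\langle A^*A\rangle$, $\langle AA^*\rangle$ are their closed linear spans in $A^*$. $A$ is identified with its canonical image in $A^{**}$. Left Arens product on $A^{**}$: $\langle m\cdot n,f\rangle=\langle m,n\cdot f\rangle$, $\langle n\cdot f,a\rangle=\langle n,f\cdot a\rangle$. Right Arens product: $\langle m\bigtriangleup n,f\rangle=\langle n,f\bigtriangleup m\rangle$, $\langle f\bigtriangleup m,a\rangle=\langle m,a\cdot f\rangle$. $Z_t^{(l)}(A^{**})$ is the set of $m\in A^{**}$ such that $n\mapsto m\cdot n$ is weak$^*$-weak$^*$ continuous on $A^{**}$; $Z_t^{(r)}(A^{**})$ is the set of $m$ such that $n\mapsto n\bigtriangleup m$ is weak$^*$-weak$^*$ continuous. $\mathcal{E}=\{E\in A^{**}:n\cdot E=E\bigtriangleup n=n\ \forall n\in A^{**}\}$ is the set of mixed identities. Types. $LM(A)=\{T\in B(A):T(ab)=T(a)b\}$, $RM(A)=\{T\in B(A):T(ab)=aT(b)\}$. For $\mu\in LM(A)$ (resp. $RM(A)$), ''$\mu\in A$'' means $\mu$ is left (resp. right) multiplication by some element of $A$; for a closed subalgebra $C$ with $\mu(C)\subseteq C$, ''$\mu|_C\in C$'' means $\mu|_C$ is left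 (resp. right) multiplication on $C$ by an element of $C$. Condition $(L)$ for a Banach algebra $B$: $B$ has a BAI and there is a family $\{B_i\}$ of closed left ideals in $B$ such that (I) each $B_i$ is WSC with a sequential (not necessarily bounded) approximate identity; (II) for each $i$ there is a linear projection $p_i$ from $B$ onto $B_i$ with $p_i(xy)=p_i(x)y$ ($x\in B$, $y\in B_i$); (III) for any $\nu\in LM(B)$, if $\nu|_{B_i}\in B_i$ for all $i$, then $\nu\in B$. Condition $(R)$ is the mirror condition: closed right ideals $B_i$, $p_i(yx)=yp_i(x)$, and $RM(B)$ in place of $LM(B)$. A Banach algebra $A$ with a BAI is of type $(LM)$ (resp. $(RM)$) if for every $\mu\in LM(A)$ (resp. $RM(A)$) there is a closed subalgebra $B$ of $A$ satisfying $(L)$ (resp. $(R)$) such that (1) $f|_B\in B^*B$ for each $f\in A^*A$ (resp. $f|_B\in BB^*$ for each $f\in AA^*$); (2) $\mu(B)\subseteq B$, and $\mu\in A$ if $\mu|_B\in B$. $A$ is of type $(M)$ if it is of type $(LM)$ and of type $(RM)$. *)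

(* Defs.v *)
(* The scalar field is [R[i]] for [R : realType]; as a target space it is
   written [R[i]^o], the spelling under which the library provides its topology
   and norm. *)
From HB Require Import structures.
From mathcomp Require Import all_boot all_order all_algebra.
From mathcomp Require Import mathcomp_extra boolp classical_sets functions.
From mathcomp Require Import reals topology normedtype.
From mathcomp.real_closed Require Import complex.

Set Implicit Arguments.
Unset Strict Implicit.
Unset Printing Implicit Defensive.

Import Order.TTheory GRing.Theory Num.Theory.
Import numFieldNormedType.Exports.

Local Open Scope classical_set_scope.
Local Open Scope ring_scope.
Local Open Scope complex_scope.

Section LinearBound.
Context (K : numFieldType) (X Y : normedModType K).

Lemma linear_continuous_bound (f : X -> Y) : linear f -> continuous f ->
  exists2 M : K, 0 <= M & forall x, `|f x| <= M * `|x|.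
Proof.
move=> flin.
pose g : {linear X -> Y} := HB.pack f (GRing.isLinear.Build _ _ _ _ _ flin).
move=> fc; have : bounded_near g (nbhs (0 : X)).
  by apply: continuous_linear_bounded; exact: fc.
by move=> /linear_boundedP/pinfty_ex_gt0 [M /ltW M0 gM]; exists M.
Qed.

Lemma bound_linear_continuous (f : X -> Y) (M : K) : linear f -> 0 <= M ->
  (forall x, `|f x| <= M * `|x|) -> continuous f.
Proof.
move=> flin M0 fM.
pose g : {linear X -> Y} := HB.pack f (GRing.isLinear.Build _ _ _ _ _ flin).
apply: (@bounded_linear_continuous _ _ _ g); apply/linear_boundedP.
exists M; split; first exact: ger0_real.
by move=> r /ltW Mr x; apply: le_trans (fM x) _; apply: ler_wpM2r.
Qed.

End LinearBound.

Section Dual.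
Context (R : realType) (X : normedModType R[i]).

Definition dual_pred : {pred X -> R[i]^o} :=
  mem [set f : X -> R[i]^o | linear f /\ continuous f].

Record dual := Dual { dual_fun :> X -> R[i]^o; _ : dual_fun \in dual_pred }.

HB.instance Definition _ := [isSub for dual_fun].
HB.instance Definition _ := [Choice of dual by <:].

Lemma dual_linear (f : dual) : linear f.
Proof. by case: f => f /= /set_mem[]. Qed.

Lemma dual_continuous (f : dual) : continuous f.
Proof. by case: f => f /= /set_mem[]. Qed.

Lemma dualP (f g : dual) : f =1 g -> f = g.
Proof. by move=> fg; apply/val_inj/funext. Qed.

Lemma dual_submod_closed : submod_closed dual_pred.
Proof.
split.
- rewrite inE; split; last exact: cst_continuous.
  by move=> a x y; rewrite /= scaler0 addr0.
- move=> a f g /set_mem[fl fc] /set_mem[gl gc]; apply/mem_set; split.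
  + move=> b x y; rewrite !fctE fl gl !scalerDr !scalerA (mulrC a b).
    by rewrite addrACA.
  + move=> x; apply: (@cvgD _ _ _ (nbhs x)); last exact: gc.
    by apply: (@cvgZl_tmp _ _ _ (nbhs x)); exact: fc.
Qed.

HB.instance Definition _ := GRing.SubChoice_isSubLmodule.Build _ _ _ dual
  (GRing.submod_closed_semi dual_submod_closed).

Definition dual_norm (f : dual) : R[i] :=
  (sup [set complex.Re `|f x| | x in [set x : X | `|x| <= 1]])%:C.

Lemma dualD (f g : dual) x : (f + g) x = f x + g x. Proof. by []. Qed.
Lemma dualZ a (f : dual) x : (a *: f) x = a *: f x. Proof. by []. Qed.
Lemma dual0 x : (0 : dual) x = 0. Proof. by []. Qed.
Lemma dualN (f : dual) x : (- f) x = - f x. Proof. by []. Qed.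

Lemma dual_linearD (f : dual) x y : f (x + y) = f x + f y.
Proof. by have := dual_linear f 1 x y; rewrite !scale1r. Qed.

Lemma dual_at0 (f : dual) : f 0 = 0.
Proof. by have := dual_linearD f 0 0; rewrite addr0 -[LHS]addr0 => /addrI. Qed.

Lemma dual_linearZ (f : dual) a x : f (a *: x) = a *: f x.
Proof. by have := dual_linear f a x 0; rewrite dual_at0 !addr0. Qed.

Let ReK (z : R[i]) : 0 <= z -> (complex.Re z)%:C = z.
Proof. by move=> z0; apply/RRe_real/ger0_real. Qed.

Let dual_bound (f : dual) :
  exists2 M : R, 0 <= M & forall x, `|f x| <= M%:C * `|x|.
Proof.
have [M M0 fM] := linear_continuous_bound (dual_linear f) (@dual_continuous f).
exists (complex.Re M); last by move=> x; rewrite ReK.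
by rewrite -lecR ReK.
Qed.

Let dual_has_sup (f : dual) :
  has_sup [set complex.Re `|f x| | x in [set x : X | `|x| <= 1]].
Proof.
split; first by exists (complex.Re `|f 0|), 0; rewrite /mkset ?normr0.
have [M M0 fM] := dual_bound f; exists M => _ [x x1 <-].
rewrite -lecR ReK//; apply: le_trans (fM x) _.
by rewrite -[leRHS]mulr1 ler_wpM2l// lecR.
Qed.

Lemma dual_norm_ge0 f : 0 <= dual_norm f.
Proof.
have F0 : complex.Re `|f 0| <= sup [set complex.Re `|f x| | x in
    [set x : X | `|x| <= 1]].
  apply: (sup_upper_bound (dual_has_sup f)).
  by exists 0; rewrite /mkset ?normr0.
by rewrite /dual_norm lecR; apply: le_trans F0; rewrite dual_at0 normr0.
Qed.

Lemma dual_norm_le (f : dual) x : `|f x| <= dual_norm f * `|x|.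
Proof.
have [->|x0] := eqVneq x 0; first by rewrite dual_at0 !normr0 mulr0.
have nx : 0 < `|x| by rewrite normr_gt0.
pose y := `|x|^-1 *: x.
have y1 : `|y| = 1 by rewrite normfZV.
have fy : `|f y| <= dual_norm f.
  rewrite -(ReK (normr_ge0 (f y))) lecR.
  by apply: (sup_upper_bound (dual_has_sup f)); exists y; rewrite /mkset ?y1.
have xE : x = `|x| *: y by rewrite scalerA divff ?scale1r// gt_eqF.
by rewrite {1}xE dual_linearZ normrZ normr_id mulrC ler_wpM2r.
Qed.

Lemma dual_norm_lub (f : dual) (M : R[i]) : 0 <= M ->
  (forall x, `|f x| <= M * `|x|) -> dual_norm f <= M.
Proof.
move=> M0 fM; rewrite -(ReK M0) lecR; apply: ge_sup.
  exact: (dual_has_sup f).1.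
move=> _ [x x1 <-]; rewrite -lecR !ReK//; apply: le_trans (fM x) _.
by rewrite -[leRHS]mulr1 ler_wpM2l.
Qed.

Lemma dual_ler_normD f g : dual_norm (f + g) <= dual_norm f + dual_norm g.
Proof.
apply: dual_norm_lub => [|x]; first by rewrite addr_ge0 ?dual_norm_ge0.
rewrite dualD mulrDl; apply: le_trans (ler_normD _ _) _.
by apply: lerD; exact: dual_norm_le.
Qed.

Let dual_normZ_le a f : dual_norm (a *: f) <= `|a| * dual_norm f.
Proof.
apply: dual_norm_lub => [|x]; first by rewrite mulr_ge0 ?dual_norm_ge0.
by rewrite dualZ normrZ -mulrA ler_wpM2l// dual_norm_le.
Qed.

Lemma dual_normZ a f : dual_norm (a *: f) = `|a| * dual_norm f.
Proof.
apply/eqP; rewrite eq_le dual_normZ_le/=.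
have [->|a0] := eqVneq a 0; first by rewrite normr0 mul0r dual_norm_ge0.
have na : 0 < `|a| by rewrite normr_gt0.
rewrite -ler_pdivlMl// -normfV.
by rewrite -{1}[f](scalerK a0) dual_normZ_le.
Qed.

Lemma dual_norm0_eq0 f : dual_norm f = 0 -> f = 0.
Proof.
move=> f0; apply: dualP => x; apply/eqP.
by rewrite -normr_le0; have := dual_norm_le f x; rewrite f0 mul0r.
Qed.

HB.instance Definition _ := Lmodule_isNormed.Build R[i] dual
  dual_ler_normD dual_normZ dual_norm0_eq0.

Definition bounded_dual (f : X -> R[i]^o) (M : R[i]) (flin : linear f)
    (M0 : 0 <= M) (fM : forall x, `|f x| <= M * `|x|) : dual :=
  Dual (mem_set (conj flin (bound_linear_continuous flin M0 fM))).

End Dual.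

Section ClosedSubspace.
Context (K : numFieldType) (X : completeNormedModType K).

Record closedSubspace := ClosedSubspace {
  cs_set :> set X;
  cs_closed : closed cs_set;
  cs_0 : cs_set 0;
  cs_linear : forall (a : K) x y, cs_set x -> cs_set y -> cs_set (a *: x + y)
}.

Section SubspaceType.
Context (S : closedSubspace).

Definition cs_pred : {pred X} := mem (cs_set S).

Record cs_type := CsType { cs_val : X; _ : cs_val \in cs_pred }.

HB.instance Definition _ := [isSub for cs_val].
HB.instance Definition _ := [Choice of cs_type by <:].

Lemma cs_valP (x : cs_type) : cs_set S (cs_val x).
Proof. by case: x => x /= /set_mem. Qed.

Lemma cs_submod_closed : submod_closed cs_pred.
Proof.
split; first exact/mem_set/cs_0.
by move=> a x y /set_mem Sx /set_mem Sy; apply/mem_set/cs_linear.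
Qed.

HB.instance Definition _ := GRing.SubChoice_isSubLmodule.Build _ _ _ cs_type
  (GRing.submod_closed_semi cs_submod_closed).

Definition cs_norm (x : cs_type) : K := `|cs_val x|.

Lemma cs_ler_normD x y : cs_norm (x + y) <= cs_norm x + cs_norm y.
Proof. exact: ler_normD. Qed.

Lemma cs_normZ a x : cs_norm (a *: x) = `|a| * cs_norm x.
Proof. exact: normrZ. Qed.

Lemma cs_norm0_eq0 x : cs_norm x = 0 -> x = 0.
Proof. by move=> /normr0_eq0 x0; exact: val_inj. Qed.

HB.instance Definition _ := Lmodule_isNormed.Build K cs_type
  cs_ler_normD cs_normZ cs_norm0_eq0.

Lemma cs_normE (x : cs_type) : `|x| = `|cs_val x|.
Proof. by []. Qed.

Lemma cs_cauchy_cvg (F : set_system cs_type) :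
  ProperFilter F -> cauchy F -> cvg F.
Proof.
move=> FF /cauchy_ballP Fc.
have vc : cauchy (cs_val @ F).
  apply/cauchy_ballP => e e0; have [[P Q] [/= FP FQ] PQ] := Fc e e0.
  exists (cs_val @` P, cs_val @` Q) => /=.
    by split; [apply: filterS FP|apply: filterS FQ] => x ?; exists x.
  move=> [_ _] [/= [p Pp <-] [q Qq <-]].
  by have := PQ (p, q) (conj Pp Qq); rewrite /= -!ball_normE.
have /cvg_ex[/= l vl] : cvg (cs_val @ F) by exact: cauchy_cvg vc.
have Sl : cs_set S l.
  apply: (closed_cvg _ (@cs_closed S)) vl.
  by apply: filterE => x; exact: cs_valP.
apply/cvg_ex; exists (CsType (mem_set Sl)).
apply/cvgrPdist_lt => e e0; move/cvgrPdist_lt : vl => /(_ e e0).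
exact.
Qed.

HB.instance Definition _ := Uniform_isComplete.Build cs_type cs_cauchy_cvg.

End SubspaceType.
End ClosedSubspace.

(* Not necessarily unital, so this does not extend the library's rings. *)
HB.mixin Record isBanachAlgebra (K : numFieldType) A
    & CompleteNormedModule K A := {
  bmul : A -> A -> A;
  bmulA : associative bmul;
  bmul_linearl : forall b, linear (fun a => bmul a b);
  bmul_linearr : forall a, linear (bmul a);
  norm_bmul_le : forall a b, `|bmul a b| <= `|a| * `|b|
}.

#[short(type="banachAlgType")]
HB.structure Definition BanachAlgebra (K : numFieldType) :=
  {A of CompleteNormedModule K A & isBanachAlgebra K A}.

Notation "a ** b" := (bmul a b) (at level 40, left associativity) : ring_scope.

Section ClosedSubalgebra.
Context (K : numFieldType) (A : banachAlgType K).

Record closedSubalgebra := ClosedSubalgebra {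
  csa_space :> closedSubspace A;
  csa_mul : forall x y, cs_set csa_space x -> cs_set csa_space y ->
    cs_set csa_space (x ** y)
}.

Section SubalgebraType.
Context (B : closedSubalgebra).

Definition csa_bmul (x y : cs_type B) : cs_type B :=
  CsType (mem_set (csa_mul (cs_valP x) (cs_valP y))).

Lemma csa_bmulA : associative csa_bmul.
Proof. by move=> x y z; apply: val_inj => /=; exact: bmulA. Qed.

Lemma csa_bmul_linearl y : linear (fun x => csa_bmul x y).
Proof. by move=> a x z; apply: val_inj; exact: bmul_linearl. Qed.

Lemma csa_bmul_linearr x : linear (csa_bmul x).
Proof. by move=> a y z; apply: val_inj; exact: bmul_linearr. Qed.

Lemma csa_norm_bmul_le x y : `|csa_bmul x y| <= `|x| * `|y|.
Proof. exact: norm_bmul_le. Qed.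

HB.instance Definition _ := isBanachAlgebra.Build K (cs_type B)
  csa_bmulA csa_bmul_linearl csa_bmul_linearr csa_norm_bmul_le.

End SubalgebraType.

End ClosedSubalgebra.

Section DualModule.
Context (R : realType) (A : banachAlgType R[i]).

Let actr_linear (f : dual A) (a : A) : linear (fun b => f (a ** b)).
Proof. by move=> c x y; rewrite bmul_linearr dual_linear. Qed.

Let actr_bound (f : dual A) (a : A) b :
  `|f (a ** b)| <= `|f| * `|a| * `|b|.
Proof.
apply: le_trans (dual_norm_le f _) _; rewrite -mulrA.
by apply: ler_wpM2l (norm_bmul_le a b); exact: dual_norm_ge0.
Qed.

Let actl_linear (f : dual A) (a : A) : linear (fun b => f (b ** a)).
Proof. by move=> c x y; rewrite bmul_linearl dual_linear. Qed.

Let actl_bound (f : dual A) (a : A) b :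
  `|f (b ** a)| <= `|f| * `|a| * `|b|.
Proof.
apply: le_trans (dual_norm_le f _) _; rewrite -mulrA (mulrC `|a|).
by apply: ler_wpM2l (norm_bmul_le b a); exact: dual_norm_ge0.
Qed.

(* <f . a, b> = <f, ab> *)
Definition dual_actr (f : dual A) (a : A) : dual A :=
  bounded_dual (actr_linear f a) (mulr_ge0 (normr_ge0 f) (normr_ge0 a))
    (actr_bound f a).

(* <a . f, b> = <f, ba> *)
Definition dual_actl (a : A) (f : dual A) : dual A :=
  bounded_dual (actl_linear f a) (mulr_ge0 (normr_ge0 f) (normr_ge0 a))
    (actl_bound f a).

Lemma dual_actrE f a b : dual_actr f a b = f (a ** b). Proof. by []. Qed.
Lemma dual_actlE f a b : dual_actl a f b = f (b ** a). Proof. by []. Qed.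

Let norm_actr f a : `|dual_actr f a| <= `|f| * `|a|.
Proof. by apply: dual_norm_lub => [|b]; [exact: mulr_ge0|exact: actr_bound]. Qed.

Let norm_actl f a : `|dual_actl a f| <= `|f| * `|a|.
Proof. by apply: dual_norm_lub => [|b]; [exact: mulr_ge0|exact: actl_bound]. Qed.

Let larens_act_linear (n : dual (dual A)) f : linear (fun a => n (dual_actr f a)).
Proof.
move=> c a b; rewrite -dual_linear; congr (n _); apply: dualP => x.
by rewrite dualD dualZ !dual_actrE bmul_linearl dual_linear.
Qed.

Let larens_act_bound (n : dual (dual A)) f a :
  `|n (dual_actr f a)| <= `|n| * `|f| * `|a|.
Proof.
apply: le_trans (dual_norm_le n _) _; rewrite -mulrA.
by apply: ler_wpM2l (norm_actr f a); exact: dual_norm_ge0.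
Qed.

Let rarens_act_linear (m : dual (dual A)) f : linear (fun a => m (dual_actl a f)).
Proof.
move=> c a b; rewrite -dual_linear; congr (m _); apply: dualP => x.
by rewrite dualD dualZ !dual_actlE bmul_linearr dual_linear.
Qed.

Let rarens_act_bound (m : dual (dual A)) f a :
  `|m (dual_actl a f)| <= `|m| * `|f| * `|a|.
Proof.
apply: le_trans (dual_norm_le m _) _; rewrite -mulrA.
by apply: ler_wpM2l (norm_actl f a); exact: dual_norm_ge0.
Qed.

(* <n . f, a> = <n, f . a> *)
Definition larens_act (n : dual (dual A)) (f : dual A) : dual A :=
  bounded_dual (larens_act_linear n f)
    (mulr_ge0 (normr_ge0 n) (normr_ge0 f)) (larens_act_bound n f).

(* <f △ m, a> = <m, a . f> *)
Definition rarens_act (f : dual A) (m : dual (dual A)) : dual A :=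
  bounded_dual (rarens_act_linear m f)
    (mulr_ge0 (normr_ge0 m) (normr_ge0 f)) (rarens_act_bound m f).

Lemma larens_actE n f a : larens_act n f a = n (dual_actr f a).
Proof. by []. Qed.
Lemma rarens_actE f m a : rarens_act f m a = m (dual_actl a f).
Proof. by []. Qed.

Let norm_larens_act n f : `|larens_act n f| <= `|n| * `|f|.
Proof.
by apply: dual_norm_lub => [|b]; [exact: mulr_ge0|exact: larens_act_bound].
Qed.

Let norm_rarens_act f m : `|rarens_act f m| <= `|m| * `|f|.
Proof.
by apply: dual_norm_lub => [|b]; [exact: mulr_ge0|exact: rarens_act_bound].
Qed.

Let larens_linear (m n : dual (dual A)) : linear (fun f => m (larens_act n f)).
Proof.
move=> c f g; rewrite -dual_linear; congr (m _); apply: dualP => a.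
rewrite dualD dualZ !larens_actE -dual_linear; congr (n _).
exact: dualP.
Qed.

Let larens_bound (m n : dual (dual A)) f :
  `|m (larens_act n f)| <= `|m| * `|n| * `|f|.
Proof.
apply: le_trans (dual_norm_le m _) _; rewrite -mulrA.
by apply: ler_wpM2l (norm_larens_act n f); exact: dual_norm_ge0.
Qed.

Let rarens_linear (m n : dual (dual A)) : linear (fun f => n (rarens_act f m)).
Proof.
move=> c f g; rewrite -dual_linear; congr (n _); apply: dualP => a.
rewrite dualD dualZ !rarens_actE -dual_linear; congr (m _).
exact: dualP.
Qed.

Let rarens_bound (m n : dual (dual A)) f :
  `|n (rarens_act f m)| <= `|n| * `|m| * `|f|.
Proof.
apply: le_trans (dual_norm_le n _) _; rewrite -mulrA.
by apply: ler_wpM2l (norm_rarens_act f m); exact: dual_norm_ge0.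
Qed.

(* <m . n, f> = <m, n . f> *)
Definition larens (m n : dual (dual A)) : dual (dual A) :=
  bounded_dual (larens_linear m n)
    (mulr_ge0 (normr_ge0 m) (normr_ge0 n)) (larens_bound m n).

(* <m △ n, f> = <n, f △ m> *)
Definition rarens (m n : dual (dual A)) : dual (dual A) :=
  bounded_dual (rarens_linear m n)
    (mulr_ge0 (normr_ge0 n) (normr_ge0 m)) (rarens_bound m n).

End DualModule.

Section Bidual.
Context (R : realType) (X : normedModType R[i]).

Let bidual_linear (x : X) : linear (fun f : dual X => f x).
Proof. by []. Qed.

Let bidual_bound (x : X) (f : dual X) : `|f x| <= `|x| * `|f|.
Proof. by rewrite mulrC; exact: dual_norm_le. Qed.

Definition bidual_emb (x : X) : dual (dual X) :=
  bounded_dual (bidual_linear x) (normr_ge0 x) (bidual_bound x).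

(* [dual X] with the topology of pointwise convergence on X; the weak* topology
   of the bidual of A is thus [weak_star (dual A)]. *)
Definition weak_star : Type := dual X.

HB.instance Definition _ := Topological.copy weak_star
  (initial_topology
    (fun f : dual X => (f : X -> R[i]^o) : {ptws X -> R[i]^o})).

Definition weakly_seq_complete : Prop := forall x : nat -> X,
  (forall f : dual X, cauchy (f (x n) @[n --> \oo])) ->
  exists l : X, forall f : dual X, f (x n) @[n --> \oo] --> f l.

End Bidual.

Section Restriction.
Context (R : realType) (X : completeNormedModType R[i]) (S : closedSubspace X).

Let restr_linear (f : dual X) : linear (fun x : cs_type S => f (cs_val x)).
Proof. by move=> a x y; rewrite -dual_linear. Qed.

Let restr_bound (f : dual X) (x : cs_type S) : `|f (cs_val x)| <= `|f| * `|x|.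
Proof. exact: dual_norm_le. Qed.

Definition dual_restr (f : dual X) : dual (cs_type S) :=
  bounded_dual (restr_linear f) (normr_ge0 f) (restr_bound f).

End Restriction.

Section ClosedSpan.
Context (K : numFieldType) (X : normedModType K).

Definition closed_span (S : set X) : set X :=
  closure [set x | exists (n : nat) (c : 'I_n -> K) (s : 'I_n -> X),
    (forall i, S (s i)) /\ x = \sum_(i < n) c i *: s i].

End ClosedSpan.

Section ApproximateIdentities.
Context (K : numFieldType) (A : banachAlgType K).

Definition directed_preorder (I : Type) (le : I -> I -> Prop) : Prop :=
  [/\ inhabited I, forall i, le i i,
      forall i j k, le i j -> le j k -> le i k &
      forall i j, exists k, le i k /\ le j k].

Definition net_tails (I : Type) (le : I -> I -> Prop) : set_system I :=
  filter_from setT (fun i => [set j | le i j]).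

Definition has_BAI : Prop :=
  exists (I : Type) (le : I -> I -> Prop) (e : I -> A) (M : K),
    [/\ directed_preorder le, forall i, `|e i| <= M &
        forall a, e i ** a @[i --> net_tails le] --> a /\
                  a ** e i @[i --> net_tails le] --> a].

Definition has_sequential_AI (C : set A) : Prop :=
  exists u : nat -> A, (forall n, C (u n)) /\
    forall x, C x -> u n ** x @[n --> \oo] --> x /\
                     x ** u n @[n --> \oo] --> x.

End ApproximateIdentities.

Section Multipliers.
Context (K : numFieldType) (A : banachAlgType K).

Definition LM (T : A -> A) : Prop :=
  [/\ linear T, continuous T & forall a b, T (a ** b) = T a ** b].

Definition RM (T : A -> A) : Prop :=
  [/\ linear T, continuous T & forall a b, T (a ** b) = a ** T b].

Definition LM_in (T : A -> A) : Prop := exists a, forall x, T x = a ** x.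

Definition RM_in (T : A -> A) : Prop := exists a, forall x, T x = x ** a.

Definition LM_restr_in (T : A -> A) (C : set A) : Prop :=
  (forall x, C x -> C (T x)) /\
  exists2 c, C c & forall x, C x -> T x = c ** x.

Definition RM_restr_in (T : A -> A) (C : set A) : Prop :=
  (forall x, C x -> C (T x)) /\
  exists2 c, C c & forall x, C x -> T x = x ** c.

Definition left_ideal (C : set A) : Prop := forall a x, C x -> C (a ** x).

Definition right_ideal (C : set A) : Prop := forall a x, C x -> C (x ** a).

(* Continuity of p is not required. *)
Definition linear_projection (C : set A) (p : A -> A) : Prop :=
  [/\ linear p, p \o p = p & range p = C].

End Multipliers.

Section Types.
Context (R : realType).
Implicit Types A B : banachAlgType R[i].

(* A^*A and AA^* *)
Definition dualA A : set (dual A) :=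
  [set dual_actr f a | f in [set: dual A] & a in [set: A]].

Definition Adual A : set (dual A) :=
  [set dual_actl a f | a in [set: A] & f in [set: dual A]].

Arguments dualA : clear implicits.
Arguments Adual : clear implicits.

Definition condition_L B : Prop :=
  has_BAI B /\
  exists (I : Type) (L : I -> closedSubspace B),
    [/\ forall i, left_ideal (cs_set (L i)),
        forall i, weakly_seq_complete (cs_type (L i)) /\
                  has_sequential_AI (cs_set (L i)),
        forall i, exists2 p : B -> B, linear_projection (cs_set (L i)) p &
          forall x y, cs_set (L i) y -> p (x ** y) = p x ** y &
        forall nu : B -> B, LM nu ->
          (forall i, LM_restr_in nu (cs_set (L i))) -> LM_in nu].

Definition condition_R B : Prop :=
  has_BAI B /\
  exists (I : Type) (L : I -> closedSubspace B),
    [/\ forall i, right_ideal (cs_set (L i)),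
        forall i, weakly_seq_complete (cs_type (L i)) /\
                  has_sequential_AI (cs_set (L i)),
        forall i, exists2 p : B -> B, linear_projection (cs_set (L i)) p &
          forall x y, cs_set (L i) y -> p (y ** x) = y ** p x &
        forall nu : B -> B, RM nu ->
          (forall i, RM_restr_in nu (cs_set (L i))) -> RM_in nu].

Definition type_LM A : Prop :=
  has_BAI A /\
  forall mu : A -> A, LM mu ->
  exists B : closedSubalgebra A,
    [/\ condition_L (cs_type B),
        forall f, dualA A f -> dualA (cs_type B) (dual_restr B f),
        forall x, cs_set B x -> cs_set B (mu x) &
        LM_restr_in mu (cs_set B) -> LM_in mu].

Definition type_RM A : Prop :=
  has_BAI A /\
  forall mu : A -> A, RM mu ->
  exists B : closedSubalgebra A,
    [/\ condition_R (cs_type B),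
        forall f, Adual A f -> Adual (cs_type B) (dual_restr B f),
        forall x, cs_set B x -> cs_set B (mu x) &
        RM_restr_in mu (cs_set B) -> RM_in mu].

Definition type_M A : Prop := type_LM A /\ type_RM A.

End Types.

Section Centres.
Context (R : realType) (A : banachAlgType R[i]).

Definition in_algebra : set (dual (dual A)) := range (@bidual_emb R A).

Definition left_centre : set (dual (dual A)) :=
  [set m | continuous (larens m : weak_star (dual A) -> weak_star (dual A))].

Definition right_centre : set (dual (dual A)) :=
  [set m | continuous
    ((fun n => rarens n m) : weak_star (dual A) -> weak_star (dual A))].

Definition mixed_identity : set (dual (dual A)) :=
  [set E | forall n, larens n E = n /\ rarens E n = n].

End Centres.
Arguments in_algebra {R} A.
Arguments left_centre {R} A.
Arguments right_centre {R} A.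
Arguments mixed_identity {R} A.
Arguments dualA {R} A.
Arguments Adual {R} A.

(* Main.v *)
(* Beyond the BAI of A, the types enter only in (iii) => (i), and the right-hand
   equivalences are the left-hand ones in the opposite algebra.  Let mu(a) = m.a, a left multiplier,
   and let B be the subalgebra attached to mu.  By condition (III) it is enough
   to see that mu is a left multiplication on each left ideal B_i.  Its
   sequential approximate identity (u_n) satisfies b u_n = p_i(b) u_n -> p_i(b)
   for b in B; by Banach-Steinhaus and the BAI of B it is therefore bounded.  A
   functional phi on B_i extends to f in A^*, and phi(mu(u_n)) = (f △ m)(u_n)
   where f △ m lies in <A^*A>, whose generators restrict to elements g.b of B^*B
   with g(b u_n) -> g(p_i(b)).  As (u_n) is bounded, phi(mu(u_n)) is Cauchy, and
   weak sequential completeness yields b_i with mu(x) = b_i x on B_i.  The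
   boundedness of (u_n) replaces the factorisation <A^*A> = A^*A. *)
Require Import Defs.
From HB Require Import structures.
From mathcomp Require Import all_boot all_order all_algebra.
From mathcomp Require Import mathcomp_extra boolp classical_sets functions.
From mathcomp Require Import reals topology normedtype sequences.
From mathcomp.real_closed Require Import complex.
From mathcomp Require Import ring lra.

Set Implicit Arguments.
Unset Strict Implicit.
Unset Printing Implicit Defensive.

Import Order.TTheory GRing.Theory Num.Theory.
Import numFieldNormedType.Exports.

Local Open Scope classical_set_scope.
Local Open Scope ring_scope.
Local Open Scope complex_scope.

(** * Restriction of scalars *)

Section LinearMaps.
Context (K : numFieldType) (X Y : normedModType K) (f : X -> Y).
Hypothesis fl : linear f.

Lemma linear_at0 : f 0 = 0.
Proof. by have := fl 1 0 0; rewrite !scale1r addr0 -[LHS]addr0 => /addrI. Qed.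

Lemma linear_homog a x : f (a *: x) = a *: f x.
Proof. by have := fl a x 0; rewrite linear_at0 !addr0. Qed.

Lemma linear_add x y : f (x + y) = f x + f y.
Proof. by have := fl 1 x y; rewrite !scale1r. Qed.

Lemma linear_opp x : f (- x) = - f x.
Proof. by rewrite -scaleN1r linear_homog scaleN1r. Qed.

Lemma linear_sub x y : f (x - y) = f x - f y.
Proof. by rewrite linear_add linear_opp. Qed.

End LinearMaps.

Section Realification.
Context (R : realType).

Lemma ReK (z : R[i]) : 0 <= z -> (complex.Re z)%:C = z.
Proof. by move=> z0; apply/RRe_real/ger0_real. Qed.

Lemma Re_ge0 (z : R[i]) : 0 <= z -> 0 <= complex.Re z.
Proof. by move=> z0; rewrite -lecR ReK. Qed.

Lemma ReM_real (a : R) (w : R[i]) : complex.Re (a%:C * w) = a * complex.Re w.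
Proof. by case: w => b c /=; rewrite mul0r subr0. Qed.

Lemma ReM_ge0 (z w : R[i]) : 0 <= z ->
  complex.Re (z * w) = complex.Re z * complex.Re w.
Proof. by move=> /ReK {1}<-; exact: ReM_real. Qed.

Lemma Re_le (z w : R[i]) : z <= w -> complex.Re z <= complex.Re w.
Proof. by rewrite lecE => /andP[]. Qed.

Lemma ReD (z w : R[i]) : complex.Re (z + w) = complex.Re z + complex.Re w.
Proof. by case: z w => [a b] []. Qed.

(** A separate alias, so that the real scalars and the [R]-valued norm do not compete with the
    complex structure on [X]. *)
Definition realification (X : normedModType R[i]) : Type := X.

Section Instances.
Context (X : normedModType R[i]).
Local Notation XR := (realification X).

HB.instance Definition _ := GRing.Zmodule.copy XR X.

Let rscale (a : R) (x : XR) : XR := (a%:C *: (x : X) : X).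

Let rscaleA a b x : rscale a (rscale b x) = rscale (a * b) x.
Proof. by rewrite /rscale scalerA -rmorphM. Qed.

Let rscale1 : left_id 1 rscale.
Proof. by move=> x; rewrite /rscale scale1r. Qed.

Let rscaleDr : right_distributive rscale +%R.
Proof. by move=> a x y; rewrite /rscale scalerDr. Qed.

Let rscaleDl v : {morph rscale^~ v : a b / a + b}.
Proof. by move=> a b; rewrite /rscale rmorphD scalerDl. Qed.

HB.instance Definition _ := GRing.Zmodule_isLmodule.Build R XR
  rscaleA rscale1 rscaleDr rscaleDl.

Lemma realification_scaleE (a : R) (x : XR) : a *: x = a%:C *: (x : X).
Proof. by []. Qed.

Let rnorm (x : XR) : R := complex.Re `|x : X|.

Let rnormD x y : rnorm (x + y) <= rnorm x + rnorm y.
Proof. by rewrite /rnorm -ReD Re_le// ler_normD. Qed.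

Let rnormZ a x : rnorm (a *: x) = `|a| * rnorm x.
Proof.
by rewrite /rnorm realification_scaleE normrZ ReM_ge0// normc_def /=
  expr0n addr0 sqrtr_sqr.
Qed.

Let rnorm0_eq0 x : rnorm x = 0 -> x = 0.
Proof. by move=> x0; apply/normr0_eq0; rewrite -[LHS]ReK// [complex.Re _]x0. Qed.

HB.instance Definition _ := Lmodule_isNormed.Build R XR rnormD rnormZ rnorm0_eq0.

Lemma realification_normE (x : XR) : `|x|%:C = `|x : X|.
Proof. exact: ReK. Qed.

End Instances.
End Realification.

Section RealificationComplete.
Context (R : realType) (X : completeNormedModType R[i]).

(** The two norms agree under [%:C], and a positive complex radius is real, so both structures have
    the same Cauchy filters and limits. *)
Let realification_cauchy_cvg (F : set_system (realification X)) :
  ProperFilter F -> cauchy F -> cvg F.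
Proof.
move=> FF /cauchy_ballP Fc.
have cF : cauchy (F : set_system X).
  apply/cauchy_ballP => e e0.
  have : 0 < complex.Re e by rewrite -ltcR ReK// ltW.
  move=> /Fc; apply: filterS => -[x y]; rewrite -!ball_normE /= => xy.
  by move: xy; rewrite -ltcR realification_normE ReK// ltW.
have /cvg_ex[/= l Fl] : cvg (F : set_system X) by exact: cauchy_cvg cF.
apply: (@cvgP (realification X) F l); apply/cvgrPdist_lt => e e0.
have : 0 < e%:C by rewrite ltcR.
move/cvgrPdist_lt : Fl => /[apply]; apply: filterS => x.
by move=> lx; rewrite -ltcR realification_normE.
Qed.

HB.instance Definition _ :=
  Uniform_isComplete.Build (realification X) realification_cauchy_cvg.

End RealificationComplete.

(** * Uniform boundedness over the complex scalars *)

Section BanachSteinhaus.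
Context (R : realType) (X : completeNormedModType R[i]) (Y : normedModType R[i]).

(* The library proves the Banach-Steinhaus theorem over a [realType] only. *)
Theorem banach_steinhaus (J : Type) (T : J -> X -> Y) :
  (forall i, linear (T i)) -> (forall i, continuous (T i)) ->
  (forall x, exists M, forall i, `|T i x| <= M) ->
  exists2 M : R[i], 0 <= M & forall i x, `|T i x| <= M * `|x|.
Proof.
move=> Tl Tc Tp.
pose T' i : realification X -> realification Y := T i.
have [|x|M MT] := @Banach_Steinhauss R (realification X) (realification Y)
    (range T') _ _ 1.
- move=> _ [i _ <-]; split; last by move=> a x y; exact: Tl.
  have [M M0 TM] := linear_continuous_bound (Tl i) (Tc i).
  move=> r; exists (complex.Re M * r) => x xr.
  rewrite -lecR; apply: le_trans (_ : M * `|x : X| <= _).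
    by rewrite realification_normE; exact: TM.
  by rewrite rmorphM /= ReK// ler_wpM2l// -realification_normE lecR.
- have [M TM] := Tp x; exists (complex.Re M) => _ [i _ <-].
  exact/Re_le/TM.
(* [M] comes without a sign and bounds the operators on the unit ball only; hence the maximum with
   [0] and the rescaling of [x] to norm one. *)
exists (Num.max M 0)%:C => [|i x]; first by rewrite lecR le_max lexx orbT.
have [->|x0] := eqVneq x 0; first by rewrite (linear_at0 (Tl i)) !normr0 mulr0.
have nx : 0 < `|x| by rewrite normr_gt0.
have xE : x = `|x| *: (`|x|^-1 *: x) by rewrite scalerA divff ?scale1r// gt_eqF.
rewrite {1}xE (linear_homog (Tl i)) normrZ normr_id mulrC ler_wpM2r//.
have /= := MT (T' i) (ex_intro2 _ _ i I erefl) (`|x|^-1 *: x : X).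
rewrite -!lecR !realification_normE normfZV// => /(_ (lexx _)) TiM.
by apply: le_trans TiM _; rewrite lecR le_max lexx.
Qed.

End BanachSteinhaus.

(** * Hahn-Banach *)

Section HahnBanachReal.
Context (R : realType) (V : lmodType R) (p : V -> R).
Hypothesis p_sub : forall x y, p (x + y) <= p x + p y.
Hypothesis p_hom : forall a x, 0 <= a -> p (a *: x) = a * p x.

(* Graphs of [p]-dominated linear functionals on subspaces; domination at [0]
   is what makes such a subspace of [V * R] single-valued. *)
Let dominated_graph (G : set (V * R)) :=
  [/\ forall a u v, G u -> G v ->
        G (a *: u.1 + v.1, a * u.2 + v.2) &
      forall u, G u -> u.2 <= p u.1].

Let p0 : p 0 = 0. Proof. by rewrite -(scale0r 0) p_hom ?mul0r. Qed.

Let graph_neg G u : dominated_graph G -> G (0, 0) -> G u -> G (- u.1, - u.2).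
Proof.
move=> [lin _] G0 Gu; have := lin (-1) _ _ Gu G0.
by rewrite /= scaleN1r mulN1r !addr0.
Qed.

Let graph_fun G x r s : dominated_graph G -> G (0, 0) ->
  G (x, r) -> G (x, s) -> r = s.
Proof.
move=> dG G0; have key u v : G (x, u) -> G (x, v) -> u <= v.
  move=> Gu Gv; have := dG.1 1 _ _ Gu (graph_neg dG G0 Gv).
  move=> /dG.2 /=; rewrite scale1r subrr p0 mul1r; lra.
by move=> Gr Gs; apply/eqP; rewrite eq_le !key.
Qed.

(** One-dimensional extension: a value [c] at [v] is admissible when [u.2 - p (u.1 - v) <= c <= p
    (w.1 + v) - w.2] on [G]. Subadditivity puts every lower bound below every upper bound, so the
    supremum of the lower ones serves. *)
Let graph_step G v : dominated_graph G -> G (0, 0) ->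
  exists2 H : set (V * R), dominated_graph H &
    G `<=` H /\ exists r, H (v, r).
Proof.
move=> dG G0.
pose low := [set u.2 - p (u.1 - v) | u in G].
have lowP u w : G u -> G w -> u.2 - p (u.1 - v) <= p (w.1 + v) - w.2.
  move=> Gu Gw; have /dG.2 /= := dG.1 1 _ _ Gu Gw.
  rewrite scale1r mul1r.
  have := p_sub (u.1 - v) (w.1 + v); rewrite addrACA addNr addr0; lra.
pose c := sup low.
have hs : has_sup low.
  split; first by exists (0 - p (0 - v)), (0, 0).
  by exists (p (0 + v) - 0) => _ [u Gu <-]; apply: (lowP u (0, 0)).
have cl u : G u -> u.2 - p (u.1 - v) <= c.
  by move=> Gu; apply: (sup_upper_bound hs); exists u.
have cu w : G w -> c <= p (w.1 + v) - w.2.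
  by move=> Gw; apply: ge_sup; [exact: hs.1|move=> _ [u Gu <-]; exact: lowP].
pose H := [set (u.1.1 + u.2 *: v, u.1.2 + u.2 * c) | u in G `*` [set: R]].
have scG a u : G u -> G (a *: u.1, a * u.2).
  by move=> Gu; have := dG.1 a _ _ Gu G0; rewrite !addr0.
exists H; last split.
- split.
  + move=> a _ _ [[u s] [/= Gu _] <-] [[w t] [/= Gw _] <-] /=.
    exists ((a *: u.1 + w.1, a * u.2 + w.2), a * s + t) => /=.
      by split=> //; exact: dG.1.
    by rewrite scalerDr scalerDl scalerA addrACA; congr (_, _); ring.
  + move=> _ [[u t] [/= Gu _] <-] /=.
    (* Division by the absolute value of [t] reduces [t > 0] to [cu] and [t < 0] to [cl]. *)
    have [t0|t0|->] := ltgtP t 0; last first.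
    * by rewrite scale0r mul0r !addr0; exact: dG.2.
    * have := cu _ (scG t^-1 _ Gu); rewrite /= => h.
      have -> : u.1 + t *: v = t *: (t^-1 *: u.1 + v).
        by rewrite scalerDr scalerA divff ?gt_eqF// scale1r.
      rewrite (p_hom _ (ltW t0)).
      have := ler_wpM2l (ltW t0) h; rewrite mulrBr mulrA divff ?gt_eqF// mul1r; lra.
    * have t1 : 0 < - t by rewrite oppr_gt0.
      have := cl _ (scG (- t)^-1 _ Gu); rewrite /= => h.
      have -> : u.1 + t *: v = (- t) *: ((- t)^-1 *: u.1 - v).
        rewrite scalerBr scalerA divff ?gt_eqF// scale1r.
        by rewrite scaleNr opprK.
      rewrite (p_hom _ (ltW t1)).
      have := ler_wpM2l (ltW t1) h; rewrite mulrBr mulrA divff ?gt_eqF// mul1r; lra.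
- by move=> [x r] Gu; exists ((x, r), 0) => //=; rewrite scale0r mul0r !addr0.
- by exists c; exists ((0, 0), 1) => //=; rewrite scale1r mul1r !add0r.
Qed.

Theorem hahn_banach_real (S : set (V * R)) : S (0, 0) ->
  (forall a u v, S u -> S v -> S (a *: u.1 + v.1, a * u.2 + v.2)) ->
  (forall u, S u -> u.2 <= p u.1) ->
  exists g : V -> R, [/\ forall a x y, g (a *: x + y) = a * g x + g y,
    forall u, S u -> g u.1 = u.2 & forall x, g x <= p x].
Proof.
move=> S0 Slin Sp.
(* Joining [S] inside [P], instead of ordering the extensions of [S], makes the union of the empty
   chain satisfy [P] as well. *)
pose P G := dominated_graph (G `|` S).
have [|G [PG maxG]] := @Zorn_bigcup _ P.
  move=> F FP totF.
  have [->|/set0P[X0 FX0]] := eqVneq F set0.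
    by rewrite bigcup_set0 /P set0U.
  have mem u : (\bigcup_(X in F) X `|` S) u -> exists2 X, F X & (X `|` S) u.
    by case=> [[X FX Xu]|Su]; [exists X => //; left|exists X0 => //; right].
  split; last by move=> u /mem[X FX Xu]; apply: (FP _ FX).2.
  move=> a u w /mem[X FX Xu] /mem[Y FY Yw].
  wlog YX : / exists2 Z, F Z & (Z `|` S) u /\ (Z `|` S) w.
    apply; have [XY|YX] := totF _ _ FX FY.
      by exists Y => //; split => //; exact: setSU XY _ Xu.
    by exists X => //; split => //; exact: setSU YX _ Yw.
  case: YX => Z FZ [Zu Zw]; have [|h] := (FP _ FZ).1 a _ _ Zu Zw.
    by left; exists Z.
  by right.
have G0 : (G `|` S) (0, 0) by right.
(* A maximal graph is defined everywhere: a missing [v] would be added by [graph_step]. *)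
have tot v : exists r, (G `|` S) (v, r).
  have [H dH [GH [r Hr]]] := graph_step v PG G0.
  have HE : H `|` S = H.
    by apply/seteqP; split=> [u [//|Su]|u]; [apply: GH; right|left].
  exists r; have : ~ ~ G (v, r).
    move=> nG; apply: (maxG H); last by rewrite /P HE.
    split; last by move=> /(_ _ Hr).
    by move=> u Gu; apply: GH; left.
  by move=> /contrapT; left.
have [g gG] := choice tot; exists g; split.
- move=> a x y; apply: (graph_fun PG G0 (gG _)).
  exact: (PG.1 a _ _ (gG x) (gG y)).
- by move=> [x r] Su; apply: (graph_fun PG G0 (gG _)); right.
- by move=> x; exact: (PG.2 _ (gG x)).
Qed.

End HahnBanachReal.

Section HahnBanach.
Context (R : realType) (X : normedModType R[i]).

Let re_i (z : R[i]) : complex.Re ('i%C * z) = - complex.Im z.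
Proof. by rewrite mulrC ReiNIm. Qed.

(* [S] is the graph of the functional to extend: the bound makes it
   single-valued. A complex-linear [F] is recovered from its real part [g] by
   [F x = g x - i g (i x)]. *)
Theorem hahn_banach (S : set (X * R[i])) (M : R[i]) : 0 <= M -> S (0, 0) ->
  (forall a u v, S u -> S v -> S (a *: u.1 + v.1, a * u.2 + v.2)) ->
  (forall u, S u -> `|u.2| <= M * `|u.1|) ->
  exists2 f : dual X, forall u, S u -> f u.1 = u.2 &
    forall x, `|f x| <= M * `|x|.
Proof.
move=> M0 S0 Slin SM.
pose p (x : realification X) := complex.Re M * `|x|.
have p_sub x y : p (x + y) <= p x + p y.
  by rewrite -mulrDr ler_wpM2l ?Re_ge0// ler_normD.
have p_hom (a : R) x : 0 <= a -> p (a *: x) = a * p x.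
  by move=> a0; rewrite /p normrZ ger0_norm// mulrCA.
pose SR := [set (u.1 : realification X, complex.Re u.2) | u in S].
have [||_ [u Su <-] /=|g [glin gS gp]] := @hahn_banach_real _ _ p p_sub p_hom SR.
- by exists (0, 0).
- move=> a _ _ [u Su <-] [v Sv <-] /=; exists (a%:C *: u.1 + v.1, a%:C * u.2 + v.2).
    exact: Slin.
  by rewrite /= ReD ReM_real.
- rewrite /p -lecR rmorphM /= (ReK M0) realification_normE.
  apply: le_trans (SM _ Su); apply: le_trans (normc_ge_Re _).
  by rewrite lecR ler_norm.
have gD x y : g (x + y) = g x + g y.
  by have := glin 1 x y; rewrite scale1r mul1r.
have gZ (a : R) (x : X) : g (a%:C *: x) = a * g x.
  have g0 : g 0 = 0 by have := gD 0 0; rewrite addr0 -[LHS]addr0 => /addrI.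
  by have := glin a x 0; rewrite g0 !addr0.
pose F (x : X) : R[i]^o := g x +i* (- g ('i%C *: x)).
have FS u : S u -> F u.1 = u.2.
  move=> Su; rewrite /F (gS (u.1, complex.Re u.2)); last by exists u.
  have := Slin 'i%C _ _ Su S0; rewrite /= !addr0 => Siu.
  rewrite (gS ('i%C *: u.1, complex.Re ('i%C * u.2))).
    by rewrite re_i opprK; case: u.2.
  by exists ('i%C *: u.1, 'i%C * u.2).
have Flin : linear F.
  move=> [a b] x y.
  have cE (z : X) : (a +i* b) *: z = a%:C *: z + b%:C *: ('i%C *: z).
    by rewrite scalerA -scalerDl; congr (_ *: _); simpc.
  have iiz (z : X) : 'i%C *: ('i%C *: z) = (-1)%:C *: z.
    by rewrite scalerA -expr2 sqr_i rmorphN1.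
  rewrite /F scalerDr !gD cE scalerDr !gD !gZ 3!scalerA.
  rewrite ![_ * _%:C]mulrC -!scalerA iiz !gZ.
  apply/eqP; rewrite eq_complex /=; apply/andP; split; apply/eqP; ring.
have FM x : `|F x| <= M * `|x|.
  have [->|Fx0] := eqVneq (F x) 0; first by rewrite normr0 mulr_ge0.
  (* Rotation by the unimodular [t] makes [F (t *: x)] real, hence equal to [g (t *: x)], which [p]
     dominates. *)
  pose t := `|F x| / F x.
  have t1 : `|t| = 1 by rewrite normf_div normr_id divff// normr_eq0.
  have Ftx : F (t *: x) = `|F x| by rewrite (linear_homog Flin) /GRing.scale/= divfK.
  have gF : g (t *: x) = complex.Re `|F x| by rewrite -Ftx.
  have := gp (t *: x); rewrite gF /p -lecR ReK// rmorphM /= ReK//.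
  by rewrite realification_normE normrZ t1 mul1r.
by exists (bounded_dual Flin M0 FM).
Qed.

(** Extend [t *: x |-> t * |x|] from the line through [x], with bound [1]. *)
Corollary norming_functional (x : X) :
  exists2 f : dual X, f x = `|x| & forall y, `|f y| <= `|y|.
Proof.
pose S : set (X * R[i]) := [set (t *: x, t * `|x|) | t in setT].
have [||a _ _ [t _ <-] [s _ <-]|_ [t _ <-]|f fS fM] := @hahn_banach S 1.
- exact: ler01.
- by exists 0 => //; rewrite scale0r mul0r.
- by exists (a * t + s) => //=; rewrite scalerDl scalerA mulrDl mulrA.
- by rewrite /= normrM normr_id normrZ mul1r.
- exists f; last by move=> y; rewrite -[leRHS]mul1r.
  by apply: (fS (x, `|x|)); exists 1 => //; rewrite scale1r mul1r.
Qed.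

(** With [d > 0] the distance bound from [x] to [S], the functional [w + t *: x |-> t] is bounded by
    [d^-1], because [|w + t *: x| = |t| |x - (- t^-1 *: w)| >= |t| d]. *)
Corollary separating_functional (S : set X) (x : X) : S 0 ->
  (forall a y z, S y -> S z -> S (a *: y + z)) -> ~ closure S x ->
  exists2 f : dual X, forall y, S y -> f y = 0 & f x != 0.
Proof.
move=> S0 Slin Sx.
have [d d0 dS] : exists2 d : R[i], 0 < d & forall y, S y -> d <= `|x - y|.
  apply: contrapT => nd; apply: Sx => U /nbhs_ballP[d /= d0 dU].
  apply: contrapT => US; apply: nd; exists d => // y Sy.
  rewrite real_leNgt ?normr_real ?(gtr0_real d0)//; apply/negP => xy.
  by apply: US; exists y; split=> //; apply: dU; rewrite -ball_normE.
pose G : set (X * R[i]) := [set (u.1 + u.2 *: x, u.2) | u in S `*` setT].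
have [|||_ [[w t] [/= Sw _] <-]|f fG _] := @hahn_banach G d^-1.
- by rewrite invr_ge0 ltW.
- by exists (0, 0) => //=; rewrite scale0r addr0.
- move=> a _ _ [[y t] [/= Sy _] <-] [[z s] [/= Sz _] <-].
  exists (a *: y + z, a * t + s) => /=; first by split=> //; exact: Slin.
  by rewrite scalerDr scalerDl scalerA addrACA.
- have [->|t0] := eqVneq t 0; first by rewrite normr0 mulr_ge0// invr_ge0 ltW.
  rewrite ler_pdivlMl//.
  have -> : w + t *: x = t *: (x - (- t^-1 *: w + 0)).
    rewrite addr0 scaleNr opprK scalerDr scalerA divff// scale1r addrC //.
  by rewrite normrZ mulrC ler_wpM2l// dS//; exact: Slin.
- exists f => [y Sy|].
    by apply: (fG (y, 0)); exists (y, 0) => //=; rewrite scale0r addr0.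
  rewrite (fG (x, 1)) ?oner_eq0//.
  by exists (0, 1) => //=; rewrite scale1r add0r.
Qed.

End HahnBanach.

Lemma norm_le_dual (R : realType) (X : normedModType R[i]) (x : X) (M : R[i]) :
  (forall f : dual X, `|f x| <= M * `|f|) -> 0 <= M -> `|x| <= M.
Proof.
move=> xM M0; have [f fx f1] := norming_functional x.
have := xM f; rewrite fx normr_id => /le_trans; apply.
by rewrite ler_piMr//; apply: dual_norm_lub => // y; rewrite mul1r.
Qed.

Lemma dual_separates (R : realType) (X : normedModType R[i]) (x y : X) :
  (forall f : dual X, f x = f y) -> x = y.
Proof.
move=> xy; apply/eqP; rewrite -subr_eq0 -normr_le0.
apply: norm_le_dual => // f.
by rewrite (linear_sub (dual_linear f)) xy subrr normr0 mul0r.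
Qed.

Lemma dual_extension (R : realType) (X : completeNormedModType R[i])
    (S : closedSubspace X) (phi : dual (cs_type S)) :
  exists f : dual X, forall x : cs_type S, f (cs_val x) = phi x.
Proof.
pose G : set (X * R[i]) := [set (cs_val x, phi x) | x in setT].
have [||a _ _ [x _ <-] [y _ <-]|_ [x _ <-]|f fG _] := @hahn_banach R X G `|phi|.
- exact: normr_ge0.
- by exists 0 => //; rewrite dual_at0.
- by exists (a *: x + y) => //; rewrite dual_linear.
- exact: dual_norm_le.
- by exists f => x; apply: (fG (cs_val x, phi x)); exists x.
Qed.

(** * Weak* topology *)

Section WeakStar.
Context (R : realType) (X : normedModType R[i]).

Let ptws_of (f : weak_star X) : {ptws X -> R[i]^o} := (f : dual X).

Lemma weak_star_cvg (F : set_system (weak_star X)) (l : dual X) : Filter F ->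
  (forall x, (f : dual X) x @[f --> F] --> l x) -> F --> (l : weak_star X).
Proof.
move=> FF Fl U; rewrite nbhsE => -[B [[C oC <-] Cl] CU].
have : ptws_of @ F --> ptws_of l.
  by apply/(@pointwise_cvgP X R[i]^o) => x; exact: Fl.
move=> /(_ C) FC; apply: filterS CU _; apply: FC.
by rewrite nbhsE; exists C.
Qed.

Lemma weak_star_eval_continuous (x : X) :
  continuous (fun f : weak_star X => (f : dual X) x : R[i]^o).
Proof.
move=> f; have : ptws_of @ nbhs f --> ptws_of f.
  exact: initial_continuous.
by move=> /(@pointwise_cvgP X R[i]^o) /(_ x).
Qed.

Lemma continuous_into_weak_star (T : topologicalType) (h : T -> weak_star X) :
  (forall x, continuous (fun t => (h t : dual X) x : R[i]^o)) -> continuous h.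
Proof. by move=> hc t; apply: weak_star_cvg => x; exact: hc. Qed.

(** Induction on [s]. If some [f0] kills [s] but not [x], subtracting the right multiple of
    evaluation at [x] from [phi] leaves a functional vanishing on the annihilator of [s]; otherwise
    [x] imposes no further condition. *)
Lemma finite_annihilator_eval (s : seq X) (phi : dual X -> R[i]^o) :
  linear phi -> (forall f : dual X, (forall x, x \in s -> f x = 0) -> phi f = 0) ->
  exists x : X, forall f, phi f = f x.
Proof.
elim: s phi => [|x s IHs] phi plin phi0.
  by exists 0 => f; rewrite dual_at0 phi0.
have [[f0 [f0s f0x]]|nf0] := pselect (exists f0 : dual X,
    (forall y, y \in s -> f0 y = 0) /\ f0 x != 0); last first.
  apply: IHs => // f fs; apply: phi0 => y; rewrite inE => /orP[/eqP->|/fs//].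
  by apply/eqP/negPn/negP => fx; apply: nf0; exists f.
pose c := phi f0 / f0 x.
have [||y phiE] := IHs (fun f => phi f - c *: f x).
- move=> a f g; rewrite plin dualD dualZ.
  by rewrite scalerDr scalerBr opprD addrACA !scalerA (mulrC a).
(* The combination of [f] and [f0] is chosen to vanish at [x] too. *)
- move=> f fs; have : phi (- (f x / f0 x) *: f0 + f) = 0.
    apply: phi0 => y; rewrite dualD dualZ inE => /orP[/eqP->|ys].
      by rewrite /GRing.scale/= mulNr divfK// addNr.
    by rewrite (f0s _ ys) (fs _ ys) scaler0 addr0.
  rewrite plin => /eqP; rewrite addrC scaleNr subr_eq0 => /eqP ->.
  by apply/eqP; rewrite subr_eq0; apply/eqP; rewrite /c /GRing.scale/=; ring.
- exists (c *: x + y) => f.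
  by rewrite dual_linear -phiE addrC subrK.
Qed.

(* The filter generated by the annihilators of finite subsets of [X] converges
   weak* to [0], so a continuous [phi] vanishes on one of them. *)
Theorem weak_star_dual (phi : dual X -> R[i]^o) : linear phi ->
  continuous (phi : weak_star X -> R[i]^o) ->
  exists x : X, forall f, phi f = f x.
Proof.
move=> plin pc.
pose ann (s : seq X) := [set f : weak_star X |
  forall x, x \in s -> (f : dual X) x = 0].
pose F := filter_from setT ann.
have FF : Filter F.
  apply: filter_fromT_filter; first by exists [::].
  move=> s t; exists (s ++ t) => f fst; split=> x xs; apply: fst;
    by rewrite mem_cat xs ?orbT.
have F0 : F --> ((0 : dual X) : weak_star X).
  apply: weak_star_cvg => x U /nbhs_singleton U0.
  by exists [:: x] => // f /(_ x (mem_head _ _)) fx; rewrite /= fx.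
have [s _ sP] : F [set f | `|phi f| < 1].
  apply: F0; have := pc (0 : dual X); rewrite /continuous_at (linear_at0 plin).
  move=> /cvgr0Pnorm_lt; apply; exact: ltr01.
apply: (finite_annihilator_eval (s := s)) => // f fs.
apply/eqP; rewrite -normr_eq0 -[_ == 0]negbK; apply/negP => pf0.
(* The annihilator is a subspace, so [f] may be rescaled until [phi] has modulus [1], against the
   bound [sP]. *)
have : `|phi (`|phi f|^-1 *: f)| < 1.
  by apply: sP => x xs; rewrite dualZ fs// scaler0.
by rewrite (linear_homog plin) normrZ normfV normr_id mulVf// ltxx.
Qed.

End WeakStar.

(** * Approximate identities and Arens products *)

Section Limits.
Context (K : numFieldType).

Lemma cvg_norm_le (X : normedModType K) (T : Type) (F : set_system T)
    (FF : ProperFilter F) (u : T -> X) (x : X) (M : K) :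
  u t @[t --> F] --> x -> M \is Num.real -> (forall t, `|u t| <= M) -> `|x| <= M.
Proof.
move=> ux Mr uM; rewrite real_leNgt ?normr_real//; apply/negP => Mx.
move/cvgrPdist_lt : ux => /(_ (`|x| - M)); rewrite subr_gt0 => /(_ Mx).
move=> /filter_ex[t xut]; have := ler_normD (x - u t) (u t).
rewrite subrK => /le_lt_trans => /(_ (`|x|)).
rewrite ltxx -falseE; suff -> : `|x - u t| + `|u t| < `|x| by apply.
by rewrite -(subrK M `|x|) ltr_leD.
Qed.

Lemma cvg_lincomb (V : normedModType K) (T : Type) (F : set_system T)
    (FF : Filter F) (a : K) (u v : T -> V) (x y : V) :
  u t @[t --> F] --> x -> v t @[t --> F] --> y ->
  (a *: u t + v t) @[t --> F] --> a *: x + y.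
Proof. by move=> ux vy; apply: cvgD => //; exact: cvgZl_tmp. Qed.

Lemma bmul_continuousl (A : banachAlgType K) (b : A) : continuous (fun a => a ** b).
Proof.
apply: (bound_linear_continuous (M := `|b|)) => //; first exact: bmul_linearl.
by move=> a; rewrite mulrC norm_bmul_le.
Qed.

Lemma net_tails_proper (I : Type) (le : I -> I -> Prop) :
  directed_preorder le -> ProperFilter (net_tails le).
Proof.
move=> [[i0] refl trans dir]; apply: filter_from_proper.
  apply: filter_fromT_filter; first by exists i0.
  move=> i j; have [k [ik jk]] := dir i j.
  by exists k => l kl; split; apply: trans kl.
by move=> i _; exists i; exact: refl.
Qed.

End Limits.

Section LinearSpan.
Context (K : numFieldType) (X : normedModType K) (S : set X).

(** The set whose closure is [closed_span S], named so that separation can be applied to it. *)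
Definition lin_span : set X :=
  [set x | exists (n : nat) (c : 'I_n -> K) (s : 'I_n -> X),
    (forall i, S (s i)) /\ x = \sum_(i < n) c i *: s i].

Lemma lin_span_sub : S `<=` lin_span.
Proof.
move=> x Sx; exists 1, (fun=> 1), (fun=> x); split=> //.
by rewrite big_ord1 scale1r.
Qed.

Lemma lin_span0 : lin_span 0.
Proof.
by exists 0, (fun=> 0), (fun=> 0); split; [case|rewrite big_ord0].
Qed.

Lemma lin_span_linear a x y :
  lin_span x -> lin_span y -> lin_span (a *: x + y).
Proof.
move=> [n [c [s [Ss ->]]]] [k [d [t [St ->]]]].
exists (n + k)%N, (fun i => match fintype.split i with
  inl j => a * c j | inr j => d j end),
  (fun i => match fintype.split i with inl j => s j | inr j => t j end).
split; first by move=> i; case: fintype.split.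
rewrite big_split_ord scaler_sumr; congr (_ + _); apply: eq_bigr => i _.
  by have /= -> := unsplitK (inl i); rewrite scalerA.
by have /= -> := unsplitK (inr i).
Qed.

End LinearSpan.

Section ClosedSpan.
Context (R : realType) (X : normedModType R[i]) (S : set (dual X)) (v : nat -> X).
Hypothesis Sv : forall f, S f -> cvg (f (v n) @[n --> \oo]).

Lemma lin_span_cvg f : lin_span S f -> cvg (f (v n) @[n --> \oo]).
Proof.
move=> [n [c [s [Ss ->]]]]; elim: n => [|n IHn] in c s Ss *.
  by rewrite big_ord0; exact: is_cvg_cst.
rewrite big_ord_recr /=.
have -> : (fun k => (\sum_(i < n) c (widen_ord (leqnSn n) i) *:
    s (widen_ord (leqnSn n) i) + c ord_max *: s ord_max) (v k)) =
    (fun k => (\sum_(i < n) c (widen_ord (leqnSn n) i) *: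
    s (widen_ord (leqnSn n) i)) (v k)) \+ (fun k => c ord_max *: s ord_max (v k)).
  by apply/funext.
apply: is_cvgD; first exact: IHn.
by apply: is_cvgZl_tmp; exact: Sv.
Qed.

(** On a bounded sequence, norm approximation of [f] by [h] in the span is uniform in [n], and
    [h (v n)] converges. *)
Lemma closed_span_cauchy (M : R[i]) f : (forall n, `|v n| <= M) ->
  closed_span S f -> cauchy (f (v n) @[n --> \oo]).
Proof.
move=> vM fS; apply: cauchy_exP => e e0.
have M0 : 0 <= M by apply: le_trans (vM 0).
have M1 : 0 < M + 1 by rewrite ltr_wpDl.
(* [M + 1] rather than [M], which may be zero. *)
have d0 : 0 < e / 2 / (M + 1) by rewrite !divr_gt0.
have [h [hS /=]] := fS _ (nbhsx_ballx f _ d0).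
rewrite -ball_normE /= => fh.
have /cvg_ex[/= l hl] := lin_span_cvg hS.
exists l; rewrite /fmap /=; move/cvgrPdist_lt : hl => /(_ (e / 2)).
rewrite divr_gt0// => /(_ isT); apply: filterS => n lh.
rewrite -ball_normE /= -(subrK (h (v n)) l) -addrA.
apply: le_lt_trans (ler_normD _ _) _; rewrite [ltRHS](splitr e) ltr_leD//.
rewrite -[leLHS]normrN opprB -dualN -dualD.
apply: le_trans (dual_norm_le _ _) _.
apply: le_trans (ler_pM (dual_norm_ge0 _) (normr_ge0 _) (ltW fh) (vM n)) _.
by rewrite mulrAC ler_pdivrMr// ler_wpM2l ?divr_ge0 ?(ltW e0)// lerDl.
Qed.

End ClosedSpan.

Section MixedIdentity.
Context (R : realType) (A : banachAlgType R[i]).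

(* The functional [h |-> lim h(e_i)], defined where the limit exists, is bounded
   and contains [A^*A] and [AA^*] in its domain; its Hahn-Banach extensions are
   mixed identities, so no weak* compactness is needed. *)
Lemma has_BAI_mixed_identity : has_BAI A -> exists E, mixed_identity A E.
Proof.
move=> [I [le [e [M [dir eM eP]]]]].
have FF := net_tails_proper dir; set F := net_tails le in FF eP.
have M0 : 0 <= M by have [[i0] _ _ _] := dir; apply: le_trans (eM i0).
pose G : set (dual A * R[i]) :=
  [set u : dual A * R[i] | u.1 (e i) @[i --> F] --> (u.2 : R[i]^o)].
have [||a u v Gu Gv|[f z] Gfz|E EG _] := @hahn_banach R (dual A) G M.
- exact: M0.
- exact: cvg_cst.
- exact: (@cvg_lincomb _ R[i]^o I F _ a _ _ _ _ Gu Gv).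
- rewrite /= mulrC; apply: (cvg_norm_le FF Gfz) => [|i].
    by rewrite ger0_real// mulr_ge0.
  by apply: le_trans (dual_norm_le f _) _; rewrite ler_wpM2l ?dual_norm_ge0.
(* Both identities reduce to the values [E (f . a) = lim f (a e_i) = f a] and
   [E (a . f) = lim f (e_i a) = f a]. *)
exists E => n; split; apply: dualP => f; congr (n _); apply: dualP => a.
  apply: (EG (dual_actr f a, f a)).
  exact: continuous_cvg (@dual_continuous _ _ f _) (eP a).2.
apply: (EG (dual_actl a f, f a)).
exact: continuous_cvg (@dual_continuous _ _ f _) (eP a).1.
Qed.

(** Test [n . E = n] at the image of [a] in the bidual. *)
Lemma mixed_identity_actr E f a : mixed_identity A E -> E (dual_actr f a) = f a.
Proof. by move=> /(_ (bidual_emb a))[/(congr1 (fun n : dual (dual A) => n f))]. Qed.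

Lemma larens_emb_emb (a b : A) :
  larens (bidual_emb a) (bidual_emb b) = bidual_emb (a ** b).
Proof. by apply: dualP. Qed.

(** Links the multiplier [a |-> m . a] to the functionals [f △ m]. *)
Lemma larens_emb_r (m : dual (dual A)) a f : larens m (bidual_emb a) f = rarens_act f m a.
Proof. by congr (m _); apply: dualP. Qed.

(** [<a . n, f> = <n, f . a>] is evaluation of [n] at a fixed functional. *)
Lemma left_centre_emb (a : A) : left_centre A (bidual_emb a).
Proof.
apply: continuous_into_weak_star => f.
by move=> n; have := @weak_star_eval_continuous R (dual A) (dual_actr f a) n.
Qed.

(* [n |-> <m . n, f>] is weak* continuous, hence evaluation at some [g], and
   testing on [A] gives [g = f △ m]. *)
Lemma left_centre_arens m n : left_centre A m -> larens m n = rarens m n.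
Proof.
move=> mc; apply: dualP => f.
have [||g gP] := @weak_star_dual R (dual A) (fun n => larens m n f).
- move=> a n1 n2; rewrite /= -dual_linear; congr (m _).
  by apply: dualP.
- move=> k; have := @weak_star_eval_continuous R (dual A) f (larens m k).
  exact: (@continuous_comp _ _ _ _ _ k (mc k)).
rewrite gP; congr (n _); apply: dualP => a.
by rewrite -larens_emb_r gP.
Qed.

(** Otherwise some [n] kills [A^*A] but not [f △ m]. Then [n . f = 0], while centrality of [m] gives
    [<n, f △ m> = <m △ n, f> = <m . n, f> = <m, n . f> = 0]. *)
Lemma rarens_act_closed_span m f : left_centre A m ->
  closed_span (dualA A) (rarens_act f m).
Proof.
move=> mc; apply: contrapT => nS.
have [|a y z|n nS0] := separating_functional _ _ nS.
- exact: lin_span0.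
- exact: lin_span_linear.
have -> : n (rarens_act f m) = rarens m n f by [].
rewrite -left_centre_arens// => /eqP; apply.
rewrite -[RHS](dual_at0 m); congr (m _); apply: dualP => a.
by apply: nS0; apply: lin_span_sub; exists f => //; exists a.
Qed.

End MixedIdentity.

(** * Multipliers *)

Section LocalMultipliers.
Context (R : realType).

Section LeftIdeal.
Context (B : banachAlgType R[i]) (C : closedSubspace B) (u : nat -> B) (p : B -> B).
Hypotheses (idC : left_ideal (cs_set C)) (uC : forall n, cs_set C (u n)).
Hypothesis uP : forall x, cs_set C x -> u n ** x @[n --> \oo] --> x /\
  x ** u n @[n --> \oo] --> x.
Hypothesis pC : linear_projection (cs_set C) p.
Hypothesis pM : forall x y, cs_set C y -> p (x ** y) = p x ** y.

(** [p] fixes [C], which contains [b u_n]; hence [b u_n = p (b u_n) = p(b) u_n], and [p b] lies in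
    [C]. *)
Lemma left_ideal_approx_cvg b : b ** u n @[n --> \oo] --> p b.
Proof.
have [_ pp rp] := pC.
have pid x : cs_set C x -> p x = x.
  by rewrite -rp => -[y _ <-]; have := congr1 (fun f => f y) pp.
have Cp : cs_set C (p b) by rewrite -rp; exists b.
apply: cvg_trans (uP Cp).2; suff -> : (fun n => b ** u n) = (fun n => p b ** u n) by [].
by apply/funext => n; rewrite -pM// pid//; exact: idC.
Qed.

(* By Banach-Steinhaus, [|b u_n| <= M |b|]; now let [b] run through a bounded
   approximate identity of [B]. *)
Lemma left_ideal_approx_bounded : has_BAI B -> exists M, forall n, `|u n| <= M.
Proof.
move=> [I [le [e [N [dir eN eP]]]]].
have FF := net_tails_proper dir.
have [|n|b|M M0 MP] := @banach_steinhaus R B B nat (fun n b => b ** u n).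
- by move=> n; exact: bmul_linearl.
- exact: bmul_continuousl.
- have /cvg_seq_bounded/pinfty_ex_gt0[M _ MP] : cvg (b ** u n @[n --> \oo]).
    by apply/cvg_ex; exists (p b); exact: left_ideal_approx_cvg.
  by exists M => n; apply: MP.
exists (M * N) => n; apply: (cvg_norm_le FF (eP (u n)).1) => [|i].
  rewrite ger0_real// mulr_ge0//.
  by have [[i0] _ _ _] := dir; apply: le_trans (eN i0).
by apply: le_trans (MP n (e i)) _; rewrite ler_wpM2l.
Qed.

End LeftIdeal.

Lemma dual_separates_cvg (X : normedModType R[i]) (v : nat -> X) (x y : X) :
  v n @[n --> \oo] --> x ->
  (forall f : dual X, f (v n) @[n --> \oo] --> f y) -> x = y.
Proof.
move=> vx vy; apply: dual_separates => f.
apply: (cvg_unique (@norm_hausdorff _ R[i]^o) _ (vy f)).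
exact: continuous_cvg (@dual_continuous _ _ f _) vx.
Qed.

Context (A : banachAlgType R[i]).

(** The core of (iii) => (i), with [m] entering only through the hypothesis that each [f] composed
    with [mu] lies in [<A^*A>]. *)
Lemma multiplier_restr_in (mu : A -> A) (B : closedSubalgebra A) : LM mu ->
  (forall f : dual A, exists2 h : dual A, closed_span (dualA A) h &
    forall x, h x = f (mu x)) ->
  condition_L (cs_type B) ->
  (forall f, dualA A f -> dualA (cs_type B) (dual_restr B f)) ->
  (forall x, cs_set B x -> cs_set B (mu x)) ->
  LM_restr_in mu (cs_set B).
Proof.
move=> [mulin mucont muM] Hmu [baiB [I [L [Lid Lwsc Lproj Lmult]]]] dualB muB.
pose nu (x : cs_type B) : cs_type B := CsType (mem_set (muB _ (cs_valP x))).
have nulin : linear nu by move=> a x y; apply: val_inj; exact: mulin.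
have nuM x y : nu (x ** y) = nu x ** y by apply: val_inj; exact: muM.
have nucont : continuous nu.
  have [M M0 muM'] := linear_continuous_bound mulin mucont.
  by apply: (bound_linear_continuous nulin M0) => x; exact: muM'.
suff [c cP] : LM_in nu.
  split=> //; exists (cs_val c); first exact: cs_valP.
  by move=> x Bx; have /(congr1 (@cs_val _ _ _)) := cP (CsType (mem_set Bx)).
apply: Lmult => // i.
have [[u [uC uP]] [p pC pM]] := ((Lwsc i).2, Lproj i).
(* [nu (u_n x) = nu(u_n) x] lies in the left ideal, which is closed. *)
have nuC x : cs_set (L i) x -> cs_set (L i) (nu x).
  move=> Cx; have ux : nu (u n ** x) @[n --> \oo] --> nu x.
    exact: continuous_cvg (nucont _) (uP x Cx).1.
  apply: (closed_cvg (cs_set (L i)) (@cs_closed _ _ (L i)) _ _ ux).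
  by apply: nearW => n; rewrite nuM; exact: Lid.
split=> //.
have [M uM] := left_ideal_approx_bounded (Lid i) uC uP pC pM baiB.
pose w n : cs_type (L i) := CsType (mem_set (nuC _ (uC n))).
have [phi|l wl] := (Lwsc i).1 w.
  (* Two extensions, from the ideal to [B] and from [B] to [A]. *)
  have [psi psiE] := dual_extension phi.
  have [f fE] := dual_extension psi.
  have [h hspan hE] := Hmu f.
  have -> : (fun n => phi (w n)) = (fun n => h (cs_val (u n))).
    by apply/funext => n; rewrite hE -psiE -fE.
  apply: (closed_span_cauchy (v := fun n => cs_val (u n)) _ uM hspan).
  move=> g /dualB [g' _ [b _ gE]].
  have -> : (fun n => g (cs_val (u n))) = (fun n => g' (b ** u n)).
    by apply/funext => n; rewrite -dual_actrE gE.
  apply/cvg_ex; exists (g' (p b)).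
  apply: continuous_cvg; first exact: dual_continuous.
  exact: left_ideal_approx_cvg.
exists (cs_val l); first exact: cs_valP.
(* [nu (u_n x)] tends to [nu x] in norm, while [f (nu (u_n) x) = (x . f)(w n)] tends to [f (l x)];
   hence [nu x = l x]. *)
move=> x Cx; apply: (@dual_separates_cvg _ (fun n => nu (u n ** x))).
  exact: continuous_cvg (nucont _) (uP x Cx).1.
move=> f; have := wl (dual_restr (L i) (dual_actl x f)).
suff -> : (fun n => f (nu (u n ** x))) =
  (fun n => dual_restr (L i) (dual_actl x f) (w n)) by [].
by apply/funext => n; rewrite nuM.
Qed.

End LocalMultipliers.

(** * Topological centres *)

Section LeftTheorem.
Context (R : realType) (A : banachAlgType R[i]) (m : dual (dual A)).

(** [mu x] is chosen to represent [m . x]. Linearity, the multiplier identity and the bound by the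
    norm of [m] are checked after pairing with functionals, which separate points. *)
Lemma left_multiplier_of_bidual :
  (forall a : A, in_algebra A (larens m (bidual_emb a))) ->
  exists2 mu : A -> A, LM mu &
    forall (f : dual A) x, f (mu x) = rarens_act f m x.
Proof.
move=> mA.
have /choice[mu muE] a : exists b, bidual_emb b = larens m (bidual_emb a).
  by have [b _ bE] := mA a; exists b.
have muf (f : dual A) x : f (mu x) = rarens_act f m x.
  by rewrite -larens_emb_r -muE.
exists mu => //.
have mulin : linear mu.
  move=> a x y; apply: dual_separates => f.
  by rewrite dual_linear !muf dual_linear.
split=> //.
- apply: (bound_linear_continuous (M := `|m|)) => // x.
  apply: norm_le_dual => [f|]; last by rewrite mulr_ge0.
  rewrite muf rarens_actE; apply: le_trans (dual_norm_le m _) _.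
  rewrite -mulrA ler_wpM2l ?dual_norm_ge0//.
  apply: dual_norm_lub => [|y]; first by rewrite mulr_ge0.
  apply: le_trans (dual_norm_le f _) _; rewrite [`|x| * _]mulrC -mulrA.
  by rewrite ler_wpM2l ?dual_norm_ge0// mulrC norm_bmul_le.
- move=> x y; apply: dual_separates => f.
  rewrite muf -(dual_actlE f) muf !rarens_actE; congr (m _).
  by apply: dualP => z; rewrite !dual_actlE bmulA.
Qed.

Theorem left_topological_centre : type_LM A ->
  let mA_sub_A := forall a : A, in_algebra A (larens m (bidual_emb a)) in
  let i := in_algebra A m in
  let ii := mA_sub_A /\ left_centre A m in
  let iii := [/\ mA_sub_A,
      forall f : dual A, closed_span (dualA A) (rarens_act f m) &
      exists E, mixed_identity A E /\ rarens m E = m] in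
  (i <-> ii) /\ (ii <-> iii).
Proof.
move=> [bai typeA] mA i ii iii.
have i_ii : i -> ii.
  move=> [a _ am]; split=> [b|]; rewrite -am; last exact: left_centre_emb.
  by rewrite larens_emb_emb; exists (a ** b).
have ii_iii : ii -> iii.
  move=> [mAA mc]; split=> // [f|]; first exact: rarens_act_closed_span.
  (* Any mixed identity serves: for central [m], [m △ E = m . E = m]. *)
  have [E EP] := has_BAI_mixed_identity bai.
  by exists E; split=> //; rewrite -left_centre_arens//; exact: (EP m).1.
have iii_i : iii -> i.
  move=> [mAA mspan [E [EP mE]]].
  have [mu muLM muf] := left_multiplier_of_bidual mAA.
  have [B [LB dualB muB muBA]] := typeA mu muLM.
  have [|a aP] := muBA; first apply: multiplier_restr_in => // f.
    by exists (rarens_act f m).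
  (* Since [mu x = a x], [f △ m = f . a]; hence [<m, f> = <m △ E, f> = <E, f . a> = f a]. *)
  exists a => //; apply: dualP => f; rewrite -mE.
  rewrite /= -(mixed_identity_actr f a EP); congr (E _); apply: dualP => x.
  by rewrite -muf aP.
by split; split=> // ?; [apply: iii_i; apply: ii_iii|apply: i_ii; exact: iii_i].
Qed.

End LeftTheorem.

(** * The opposite algebra and the right-hand equivalences *)

Section OppositeAlgebra.
Context (R : realType).

(** Only the multiplication is reversed; the normed space is copied, so duals, biduals and closed
    subspaces are shared with [A]. *)
Definition opposite (A : banachAlgType R[i]) : Type := A.

Section Instance.
Context (A : banachAlgType R[i]).

HB.instance Definition _ := CompleteNormedModule.copy (opposite A) A.

Let opp_bmul (a b : opposite A) : opposite A := (b : A) ** a.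

Let opp_bmulA : associative opp_bmul.
Proof. by move=> a b c; rewrite /opp_bmul bmulA. Qed.

Let opp_linearl b : linear (fun a => opp_bmul a b).
Proof. exact: bmul_linearr. Qed.

Let opp_linearr a : linear (opp_bmul a).
Proof. exact: bmul_linearl. Qed.

Let opp_norm_le a b : `|opp_bmul a b| <= `|a| * `|b|.
Proof. by rewrite mulrC; exact: norm_bmul_le. Qed.

HB.instance Definition _ := isBanachAlgebra.Build R[i] (opposite A)
  opp_bmulA opp_linearl opp_linearr opp_norm_le.

End Instance.

Context (A : banachAlgType R[i]).

Definition opposite_subalgebra (B : closedSubalgebra A) :
    closedSubalgebra (opposite A) :=
  @ClosedSubalgebra _ (opposite A) (csa_space B)
    (fun x y Bx By => @csa_mul _ A B y x By Bx).

Lemma has_BAI_opposite : has_BAI A -> has_BAI (opposite A).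
Proof.
move=> [I [le [e [M [dir eM eP]]]]]; exists I, le, e, M; split=> // a.
by have [? ?] := eP a; split.
Qed.

Lemma has_BAI_opposite_subalgebra (B : closedSubalgebra A) :
  has_BAI (cs_type B) -> has_BAI (cs_type (opposite_subalgebra B)).
Proof.
move=> [I [le [e [M [dir eM eP]]]]]; exists I, le, e, M; split=> // a.
by have [? ?] := eP a; split.
Qed.

Lemma condition_opposite (B : closedSubalgebra A) :
  condition_R (cs_type B) -> condition_L (cs_type (opposite_subalgebra B)).
Proof.
move=> [/has_BAI_opposite_subalgebra bai [I [L [Lid Lwsc Lproj Lmult]]]].
split=> //; exists I, L; split.
- by move=> i a x; exact: Lid.
- move=> i; have [wsc [u [uC uP]]] := Lwsc i; split=> //.
  by exists u; split=> // x Cx; have [? ?] := uP x Cx; split.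
- by move=> i; have [p pC pM] := Lproj i; exists p.
- move=> nu [nulin nuc nuM] nuL; apply: Lmult.
    by split=> // a b; exact: nuM.
  exact: nuL.
Qed.

Lemma type_opposite : type_RM A -> type_LM (opposite A).
Proof.
move=> [/has_BAI_opposite bai typeA]; split=> // mu [mulin muc muM].
have [|B [RB dualB muB muBA]] := typeA mu.
  by split=> // a b; exact: muM.
exists (opposite_subalgebra B); split=> //.
- exact: condition_opposite.
- move=> f [g _ [a _ gaf]].
  have [|b _ [h _ hE]] := dualB f.
    by exists a => //; exists g => //; rewrite -gaf; exact: dualP.
  exists h => //; exists b => //; apply: dualP => x.
  by have := congr1 (fun k : dual (cs_type B) => k x) hE.
Qed.

End OppositeAlgebra.

Section RightTheorem.
Context (R : realType) (A : banachAlgType R[i]).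

(** The underlying functions coincide, but the proofs packed with them differ; hence a pointwise
    equality here and in the following transfers. *)
Lemma dual_actr_opposite (f : dual A) (a : A) :
  @dual_actr R (opposite A) f a = dual_actl a f.
Proof. exact: dualP. Qed.

Lemma dual_actl_opposite (a : A) (f : dual A) :
  @dual_actl R (opposite A) a f = dual_actr f a.
Proof. exact: dualP. Qed.

Lemma larens_act_opposite (m : dual (dual A)) (f : dual A) :
  @larens_act R (opposite A) m f = rarens_act f m.
Proof. by apply: dualP => a; have := congr1 m (dual_actr_opposite f a). Qed.

Lemma rarens_act_opposite (f : dual A) (m : dual (dual A)) :
  @rarens_act R (opposite A) f m = larens_act m f.
Proof. by apply: dualP => a; have := congr1 m (dual_actl_opposite a f). Qed.

Lemma larens_opposite (m n : dual (dual A)) :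
  @larens R (opposite A) m n = rarens n m.
Proof. by apply: dualP => f; have := congr1 m (larens_act_opposite n f). Qed.

Lemma rarens_opposite (m n : dual (dual A)) :
  @rarens R (opposite A) m n = larens n m.
Proof. by apply: dualP => f; have := congr1 n (rarens_act_opposite f m). Qed.

(** Needed because (iv) and (v) use [a . m], whereas the opposite algebra produces [a △ m]. *)
Lemma rarens_emb_l (a : A) (m : dual (dual A)) :
  rarens (bidual_emb a) m = larens (bidual_emb a) m.
Proof. by apply: dualP => f; congr (m _); apply: dualP. Qed.

Lemma dualA_opposite : dualA (opposite A) = Adual A.
Proof.
apply/seteqP; split=> [_ [f _ [a _ <-]]|_ [a _ [f _ <-]]].
  by exists a => //; exists f => //; exact: dualP.
by exists f => //; exists a => //; exact: dualP.
Qed.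

Lemma left_centre_opposite (m : dual (dual A)) :
  left_centre (opposite A) m <-> right_centre A m.
Proof.
have e : (fun n : dual (dual A) => rarens n m) =
    (@larens R (opposite A) m : dual (dual A) -> dual (dual A)).
  by apply: funext => n; have := esym (larens_opposite m n).
by rewrite /right_centre /left_centre /mkset e.
Qed.

Lemma mixed_identity_opposite : mixed_identity (opposite A) = mixed_identity A.
Proof.
apply/seteqP; split=> E EP n; have [nE En] := EP n; split.
- exact: etrans (esym (rarens_opposite E n)) En.
- exact: etrans (esym (larens_opposite n E)) nE.
- exact: etrans (larens_opposite n E) En.
- exact: etrans (rarens_opposite E n) nE.
Qed.

Theorem right_topological_centre (m : dual (dual A)) : type_RM A ->
  let Am_sub_A := forall a : A, in_algebra A (larens (bidual_emb a) m) in
  let i := in_algebra A m in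
  let iv := [/\ Am_sub_A,
      forall f : dual A, closed_span (Adual A) (larens_act m f) &
      exists E, mixed_identity A E /\ larens E m = m] in
  let v := Am_sub_A /\ right_centre A m in
  (i <-> iv) /\ (iv <-> v).
Proof.
move=> /type_opposite typeA Am i iv v.
have [i_ii ii_iii] := left_topological_centre (m : dual (dual (opposite A))) typeA.
have AmE (a : A) : @larens R (opposite A) m (@bidual_emb R (opposite A) a) =
    larens (bidual_emb a) m.
  exact: etrans (larens_opposite m (bidual_emb a)) (rarens_emb_l a m).
have AmP : (forall a : opposite A, in_algebra (opposite A)
    (larens (m : dual (dual (opposite A))) (bidual_emb a))) <-> Am.
  by split=> mA a; have := mA a; rewrite AmE.
have spanP (f : dual A) : closed_span (dualA (opposite A))
    (@rarens_act R (opposite A) f m) <-> closed_span (Adual A) (larens_act m f).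
  by rewrite rarens_act_opposite dualA_opposite.
have mixP (E : dual (dual A)) : (mixed_identity (opposite A) E /\
    @rarens R (opposite A) m E = m) <-> (mixed_identity A E /\ larens E m = m).
  by rewrite mixed_identity_opposite rarens_opposite.
have [vl vr] := left_centre_opposite m.
(* In the opposite algebra (ii) reads as (v) and (iii) as (iv), so the left-hand chain yields all
   four implications. *)
split; last apply: iff_sym; split.
- move=> im; have [mA mspan [E EP]] := ii_iii.1 (i_ii.1 im); split.
  + exact: AmP.1 mA.
  + exact: (fun f => (spanP f).1 (mspan f)).
  + exact: ex_intro _ E ((mixP E).1 EP).
- move=> [mA mspan [E EP]]; apply: i_ii.2; apply: ii_iii.2; split.
  + exact: AmP.2 mA.
  + exact: (fun f => (spanP f).2 (mspan f)).
  + exact: ex_intro _ E ((mixP E).2 EP).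
- move=> [mA mc].
  have [_ mspan [E EP]] := ii_iii.1 (conj (AmP.2 mA) (vr mc)); split.
  + exact: mA.
  + exact: (fun f => (spanP f).1 (mspan f)).
  + exact: ex_intro _ E ((mixP E).1 EP).
- move=> [mA mspan [E EP]].
  have [] := ii_iii.2 _; last by move=> _ mc; split; [exact: mA|exact: vl].
  split.
  + exact: AmP.2 mA.
  + exact: (fun f => (spanP f).2 (mspan f)).
  + exact: ex_intro _ E ((mixP E).2 EP).
Qed.

End RightTheorem.

Theorem theorem18 (R : realType) (A : banachAlgType R[i])
    (m : dual (dual A)) :
  let mA_sub_A := forall a : A, in_algebra A (larens m (bidual_emb a)) in
  let Am_sub_A := forall a : A, in_algebra A (larens (bidual_emb a) m) in
  let i := in_algebra A m in
  let ii := mA_sub_A /\ left_centre A m in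
  let iii := [/\ mA_sub_A,
      forall f : dual A, closed_span (dualA A) (rarens_act f m) &
      exists E, mixed_identity A E /\ rarens m E = m] in
  let iv := [/\ Am_sub_A,
      forall f : dual A, closed_span (Adual A) (larens_act m f) &
      exists E, mixed_identity A E /\ larens E m = m] in
  let v := Am_sub_A /\ right_centre A m in
  [/\ type_LM A -> (i <-> ii) /\ (ii <-> iii),
      type_RM A -> (i <-> iv) /\ (iv <-> v) &
      type_M A ->
        [/\ i <-> ii, ii <-> iii, iii <-> iv & iv <-> v]].
Proof.
move=> mA_sub_A Am_sub_A i ii iii iv v.
have left_part := @left_topological_centre R A m.
have right_part := @right_topological_centre R A m.
split=> [typeA|typeA|[typeL typeR]]; [exact: left_part|exact: right_part|].
have [i_ii ii_iii] := left_part typeL; have [i_iv iv_v] := right_part typeR.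
split=> //; apply: iff_trans i_iv; apply: iff_sym.
exact: iff_trans i_ii ii_iii.
Qed.
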